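(* Let $\beta,b\in\mathbb{N}^m$ and $A=[A_1|\cdots|A_n]\in\mathbb{N}^{m\times n}$ be such that $\beta\geq b$ and $\beta\geq A_k$ for every $1\leq k\leq n$. Consider the polyhedral cone $$C_\beta:=\{\xi\in\mathbb{R}^s:(\Delta\Theta)'\xi\geq0\}$$ and, for $\xi=(\xi_z)\in C_\beta$, the polynomial $p_\xi\in\mathbb{R}[u_1,\dots,u_m]$ defined by $$p_\xi(u):=\sum_{z\in\mathbb{N}^m,\ z\neq0,\ z\leq\beta}\xi_z\,u^z.$$ Consider the following two statements: (a) The system $Ax=b$ has an integer solution $x\in\mathbb{N}^n$. (b) $p_\xi(b)<0$ for some $\xi\in C_\beta$. Then one and only one of the statements (a) or (b) is true.
   Context: $\mathbb{N}=\{0,1,2,\dots\}$; prime denotes transpose; inequalities between vectors are entrywise; $A_k$ is the $k$-th column of $A$ and $A_{j;k}$ its $j$-th entry. For vectors $w,z$ with $z\in\mathbb{N}^m$, $w^z:=w_1^{z_1}\cdots w_m^{z_m}$ with $0^0=1$. Set $s:=\prod_{j=1}^m(1+\beta_j)$ and $p:=\sum_{k=1}^n\prod_{j=1}^m(1+\beta_j-A_{j;k})$. Vectors in $\mathbb{R}^s$ are indexed by the $z\in\mathbb{N}^m$ with $z\leq\beta$. The matrix $\Delta\in\mathbb{N}^{s\times s}$ has rows and columns indexed by $z,w\in\mathbb{N}^m$ with $z,w\leq\beta$ and entries $\Delta[z;w]=w^z$. The matrix $\Theta\in\mathbb{Z}^{s\times p}$ has rows indexed by $w\in\mathbb{N}^m$,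 $w\leq\beta$, and columns indexed by pairs $(k,u)$ with $1\leq k\leq n$, $u\in\mathbb{N}^m$, $u\leq\beta-A_k$; its column $(k,u)$ has entry $-1$ in row $w=u$, entry $1$ in row $w=u+A_k$, and $0$ elsewhere, i.e. $\Theta[w;(k,u)]=\mathbf{1}_{\{w=u+A_k\}}-\mathbf{1}_{\{w=u\}}$. *)

(* Defs.v *)
From HB Require Import structures.
From mathcomp Require Import all_boot all_order all_algebra.
From mathcomp Require Import mpoly.
From mathcomp Require Import reals.

Set Implicit Arguments.
Unset Strict Implicit.
Unset Printing Implicit Defensive.

Import Order.TTheory GRing.Theory Num.Theory.
Local Open Scope ring_scope.

Section Defs.
Variable m : nat.
Implicit Types (beta v w z : 'cV[nat]_m).

Definition levec v w : Prop := forall j, (v j 0%R <= w j 0%R)%N.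

(* Truncated entrywise difference; only meaningful when [levec w v]. *)
Definition subvec v w : 'cV[nat]_m := \col_j (v j 0%R - w j 0%R)%N.

(* In nat, 0 ^ 0 = 1. *)
Definition vpow w z : nat := (\prod_j w j 0%R ^ z j 0%R)%N.

(* The finite type of the z in N^m with z <= beta. *)
Definition box beta : finType := {dffun forall j : 'I_m, 'I_(beta j 0%R).+1}.

Definition box_vec beta (z : box beta) : 'cV[nat]_m := \col_j (z j : nat).

Lemma card_box beta : #|box beta| = (\prod_j (1 + beta j 0%R))%N.
Proof.
by rewrite card_dep_ffun foldrE big_map big_enum; apply: eq_bigr => j _;
  rewrite card_ord.
Qed.

Lemma box_vecP beta z : levec z beta <-> exists y : box beta, box_vec y = z.
Proof.
split=> [le_zb | [y <-] j]; last by rewrite mxE -ltnS.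
exists [ffun j => inord (z j 0%R)]; apply/colP => j.
by rewrite mxE ffunE inordK // ltnS.
Qed.

Lemma box_vec_inj beta : injective (@box_vec beta).
Proof.
move=> y z /colP eq_yz; apply/ffunP => j; apply: val_inj.
by have := eq_yz j; rewrite !mxE.
Qed.

Variable n : nat.
Implicit Type A : 'M[nat]_(m, n).

(* Pairs (k, u) with u <= beta - A_k. *)
Definition colidx beta A : finType :=
  {k : 'I_n & box (subvec beta (col k A))}.

Lemma card_colidx beta A :
  #|colidx beta A| = (\sum_k \prod_j (1 + (beta j 0%R - A j k)))%N.
Proof.
rewrite card_tagged sumnE big_map big_enum; apply: eq_bigr => k _.
by rewrite card_box; apply: eq_bigr => j _; rewrite !mxE.
Qed.

(* Matrices are indexed by ordinals; [enum_val] and [enum_rank] transport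
   between 'I_#|T| and a finite type T. *)
Definition Delta beta : 'M[nat]_(#|box beta|, #|box beta|) :=
  \matrix_(z, w) vpow (box_vec (enum_val w)) (box_vec (enum_val z)).

Definition Theta beta A : 'M[int]_(#|box beta|, #|colidx beta A|) :=
  \matrix_(w, c)
    let W := box_vec (enum_val w) in
    let k := tag (enum_val c) in
    let u := box_vec (tagged (enum_val c)) in
    ((W == u + col k A)%:R - (W == u)%:R).

Definition DeltaTheta beta A : 'M[int]_(#|box beta|, #|colidx beta A|) :=
  map_mx Posz (Delta beta) *m Theta beta A.

Definition cone (R : realType) beta A (xi : 'cV[R]_#|box beta|) : Prop :=
  forall c, 0 <= ((map_mx intr (DeltaTheta beta A))^T *m xi) c 0.

Definition mnm_of_vec z : 'X_{1..m} := [multinom z j 0%R | j < m].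

Definition pxi (R : realType) beta (xi : 'cV[R]_#|box beta|) : {mpoly R[m]} :=
  \sum_(z : box beta | box_vec z != 0)
     xi (enum_rank z) 0 *: 'X_[mnm_of_vec (box_vec z)].

End Defs.

(* Main.v *)
(* Write f(w) for the sum over z <= beta of xi_z w^z, so that p_xi(b) is
   f(b) - f(0), and xi lies in C_beta iff f(u) <= f(u + A_k) whenever u + A_k
   stays in the box. If b = A x, adding the columns of A one at a time climbs
   from 0 to b, hence f(0) <= f(b). Otherwise, let f be 0 on the points of the
   form A x and -1 elsewhere: f is nondecreasing along columns, f(0) = 0 and
   f(b) = -1, and tensor-product Lagrange interpolation (Delta is a Kronecker
   product of Vandermonde matrices) provides the coefficients xi. *)
Require Import Defs.
From HB Require Import structures.
From mathcomp Require Import all_boot all_order all_algebra.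
From mathcomp Require Import mpoly.
From mathcomp Require Import reals boolp.

Set Implicit Arguments.
Unset Strict Implicit.
Unset Printing Implicit Defensive.

Import Order.TTheory GRing.Theory Num.Theory.
Local Open Scope ring_scope.

Lemma unitmx_Vandermonde (K : fieldType) (N : nat) (a : 'rV[K]_N) :
  injective (a 0) -> Vandermonde N a \in unitmx.
Proof.
move=> inj_a; rewrite unitmxE unitfE det_Vandermonde.
apply/prodf_neq0 => i _; apply/prodf_neq0 => j lt_ij.
by rewrite subr_eq0; apply: contraTneq lt_ij => /inj_a ->; rewrite ltnn.
Qed.

(** The side lengths of the box vary with the coordinate, so expanding a product of sums over it
    ranges over dependent functions. *)
Lemma bigA_distr_dffun (K : comPzSemiRingType) (I : finType)
    (T_ : I -> finType) (F : forall i, T_ i -> K) :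
  \prod_i \sum_(j : T_ i) F i j
    = \sum_(f : {dffun forall i, T_ i}) \prod_i F i (f i).
Proof.
pose F' i : {ffun T_ i -> K} := [ffun j => F i j].
rewrite (reindex (@dffun_of_fprod I T_)); last first.
  exact/onW_bij/dffun_of_fprod_bij.
transitivity (\sum_(t : fprod T_) \prod_i F' i (t i)); last first.
  by apply: eq_bigr => t _; apply: eq_bigr => i _; rewrite !ffunE.
(* Dependent functions become functions into the disjoint union of the [T_ i]. The default 0 of
   [untag] is never reached, since [tagged_with] forces the right tag. *)
rewrite big_fprod -(bigA_distr_big_dep (tagged_with T_) (fun i => untag 0 (F' i))).
apply: eq_bigr => i _.
by rewrite -(big_tag (fun i => F' i)); apply: eq_bigr => j _; rewrite ffunE.
Qed.

Section Evaluation.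
Variables (R : realType) (m : nat) (beta : 'cV[nat]_m).
Implicit Types (xi : 'cV[R]_#|box beta|) (u v w : 'cV[nat]_m).

(* [box_eval xi] is p_xi + xi_0 as a function on N^m; on the box its values
   form the vector Delta' xi. *)
Definition box_eval xi w : R :=
  \sum_(z : box beta) xi (enum_rank z) 0 * (vpow w (box_vec z))%:R.

(** With $0^0=1$, only the constant monomial survives at the origin, so [box_eval xi 0] is the
    coefficient of index 0. *)
Lemma vpow0l v : vpow 0 v = (v == 0).
Proof.
rewrite /vpow; have [->|vN0] := eqVneq v 0.
  by rewrite big1 // => j _; rewrite mxE expn0.
have [j vj] : exists j, v j 0 != 0%N.
  apply/existsP; apply: contraNT vN0; rewrite negb_exists => /forallP v0.
  by apply/eqP/colP => j; rewrite mxE; apply/eqP; have := v0 j; rewrite negbK.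
by rewrite (bigD1 j) //= mxE exp0n ?mul0n // lt0n.
Qed.

Lemma meval_pxi xi w :
  (pxi xi).@[fun j => (w j 0)%:R] = box_eval xi w - box_eval xi 0.
Proof.
rewrite /box_eval -sumrB (bigID (fun z : box beta => box_vec z == 0)) /=.
rewrite [X in X + _]big1 => [|z /eqP z0]; last first.
  rewrite z0 -mulrBr vpow0l eqxx /vpow big1 ?subrr ?mulr0 // => j _.
  by rewrite mxE expn0.
rewrite add0r /pxi raddf_sum; apply: eq_bigr => z zN0 /=.
rewrite mevalZ mevalX vpow0l (negPf zN0) mulr0 subr0 /vpow; congr (_ * _).
by rewrite natr_prod; apply: eq_bigr => j _; rewrite natrX mnmE.
Qed.

Lemma sum_enum_val_box (K : pzSemiRingType) (g : 'cV[nat]_m -> K) v :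
  levec v beta ->
  \sum_(w < #|box beta|)
     g (box_vec (enum_val w)) * (box_vec (enum_val w) == v)%:R = g v.
Proof.
move/box_vecP => [y <-]; rewrite (bigD1 (enum_rank y)) //= enum_rankK eqxx mulr1.
rewrite big1 ?addr0 // => w wNy; rewrite (inj_eq (@box_vec_inj _ _)).
by rewrite (can2_eq enum_valK enum_rankK) (negPf wNy) mulr0.
Qed.

(** Column [c] of [Theta] is the indicator of row [v] minus that of row [u]. Multiplying by [Delta]
    thus gives its column [v] minus its column [u], and pairing a column of [Delta] with [xi] is
    evaluation at that point. *)
Lemma DeltaTheta_mul n (A : 'M[nat]_(m, n)) xi (c : colidx beta A) :
  let u := box_vec (tagged c) in let v := u + col (tag c) A in
  levec u beta -> levec v beta ->
  ((map_mx intr (DeltaTheta beta A))^T *m xi) (enum_rank c) 0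
    = box_eval xi v - box_eval xi u.
Proof.
move=> u v leu lev; rewrite mxE /box_eval -sumrB.
rewrite (reindex (@enum_rank (box beta))) /=; last first.
  exact/onW_bij/enum_rank_bij.
apply: eq_bigr => z _; rewrite !mxE mulrC -mulrBr; congr (_ * _).
rewrite (eq_bigr (fun w : 'I_#|box beta| =>
    Posz (vpow (box_vec (enum_val w)) (box_vec z))
      * (box_vec (enum_val w) == v)%:R
    - Posz (vpow (box_vec (enum_val w)) (box_vec z))
      * (box_vec (enum_val w) == u)%:R)) => [|w _]; last first.
  by rewrite !mxE !enum_rankK mulrBr.
rewrite sumrB (sum_enum_val_box (fun w => Posz (vpow w (box_vec z)))) //.
rewrite (sum_enum_val_box (fun w => Posz (vpow w (box_vec z)))) //.
by rewrite rmorphB.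
Qed.

(** As $A_k\leq\beta$, the truncated difference in [subvec] is exact, so $u\leq\beta-A_k$ means
    $u+A_k\leq\beta$. *)
Lemma cone_box_eval n (A : 'M[nat]_(m, n)) xi :
  (forall k, levec (col k A) beta) ->
  cone A xi <-> forall k u, levec (u + col k A) beta ->
    box_eval xi u <= box_eval xi (u + col k A).
Proof.
move=> hA; split=> [xi_cone k u leuA | mono c].
  have leu : levec u beta.
    by move=> j; apply: leq_trans (leuA j); rewrite mxE leq_addr.
  have [|y yE] := (box_vecP (subvec beta (col k A)) u).1.
    by move=> j; have := leuA j; have := hA k j; rewrite !mxE => le_Ab;
       rewrite leq_subRL // addnC.
  pose c : colidx beta A :=
    Tagged (fun k => box (subvec beta (col k A))) y.
  have := xi_cone (enum_rank c).
  by rewrite DeltaTheta_mul /= ?yE // subr_ge0.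
rewrite -(enum_valK c); case: (enum_val c) => k y.
have leuA : levec (box_vec y + col k A) beta.
  have le_u : levec (box_vec y) (subvec beta (col k A)).
    by apply/box_vecP; exists y.
  move=> j; move: (box_vec y) le_u => u /(_ j); have := hA k j.
  by rewrite !mxE => le_Ab; rewrite leq_subRL // addnC.
have leu : levec (box_vec y) beta.
  by move=> j; apply: leq_trans (leuA j); rewrite [leqRHS]mxE leq_addr.
by rewrite DeltaTheta_mul //= subr_ge0 mono.
Qed.

(** The box is a grid with nodes $0,\dots,\beta_j$ in direction $j$. Products of one-variable
    Lagrange polynomials have degree at most $\beta_j$ in the $j$-th variable, so the box also
    indexes their coefficients. *)
Lemma box_eval_interpolation (f : 'cV[nat]_m -> R) :
  exists xi, forall w, levec w beta -> box_eval xi w = f w.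
Proof.
pose V j : 'M[R]_((beta j 0).+1) := Vandermonde _ (\row_i i%:R).
(* Row [y] of the inverse Vandermonde matrix lists the coefficients of the Lagrange polynomial that
   is 1 at node [y] and 0 at the other nodes. *)
have VK j (y x : 'I_(beta j 0).+1) :
    \sum_i invmx (V j) y i * x%:R ^+ i = (y == x)%:R.
  have Vu : V j \in unitmx.
    by apply: unitmx_Vandermonde => a c; rewrite !mxE => /eqP;
       rewrite eqr_nat => /eqP/val_inj.
  have := congr1 (fun M : 'M_((beta j 0).+1) => M y x) (mulVmx Vu).
  by rewrite mxE [RHS]mxE => <-; apply: eq_bigr => i _; rewrite !mxE.
pose L (y z : box beta) := \prod_j invmx (V j) (y j) (z j).
exists (\col_i \sum_y f (box_vec y) * L y (enum_val i)).
move=> _ /box_vecP[x <-]; rewrite /box_eval.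
under eq_bigr => z _ do rewrite mxE enum_rankK mulr_suml.
rewrite exchange_big /=.
have sumL y : \sum_z f (box_vec y) * L y z * (vpow (box_vec x) (box_vec z))%:R
    = f (box_vec y) * (y == x)%:R.
  under eq_bigr => z _ do rewrite -mulrA /vpow natr_prod -big_split /=.
  rewrite -mulr_sumr; congr (_ * _).
  under eq_bigr => z _ do under eq_bigr => j _ do rewrite natrX !mxE.
  (* The sum over [z] factors into one-variable sums, each a Kronecker delta by [VK]. *)
  rewrite -(bigA_distr_dffun
    (fun j i => invmx (V j) (y j) i * (x j : nat)%:R ^+ i)).
  under eq_bigr => j _ do rewrite VK.
  have [->|yNx] := eqVneq y x; first by rewrite big1 // => j _; rewrite eqxx.
  have [j yj] : exists j, y j != x j.
    apply/existsP; apply: contraNT yNx; rewrite negb_exists => /forallP yx.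
    by apply/eqP/ffunP => j; apply/eqP; have := yx j; rewrite negbK.
  by rewrite (bigD1 j) //= (negPf yj) mul0r.
rewrite (bigD1 x) //= sumL eqxx mulr1 big1 ?addr0 // => y yNx.
by rewrite sumL (negPf yNx) mulr0.
Qed.
End Evaluation.

(** Induction on the sum of the entries of [x]: dropping one copy of a column only decreases $Ax$,
    so the path stays in the box. *)
Lemma le_of_nondecreasing_columns (R : realType) m n (beta : 'cV[nat]_m)
    (A : 'M[nat]_(m, n))
    (F : 'cV[nat]_m -> R) (x : 'cV[nat]_n) :
  (forall k u, levec (u + col k A) beta -> F u <= F (u + col k A)) ->
  levec (A *m x) beta -> F 0 <= F (A *m x).
Proof.
move=> mono; have [N] := ubnP (\sum_k x k 0%R)%N; elim: N x => // N IH x ltN leAx.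
have [->|xN0] := eqVneq x 0; first by rewrite mulmx0.
have [k xk] : exists k, x k 0 != 0%N.
  apply/existsP; apply: contraNT xN0; rewrite negb_exists => /forallP x0.
  by apply/eqP/colP => j; rewrite mxE; apply/eqP; have := x0 j; rewrite negbK.
(* Since [x k 0] is nonzero, this subtraction does not truncate. *)
pose x' : 'cV[nat]_n := \col_i (x i 0%R - (i == k))%N.
have xE : x = x' + delta_mx k 0.
  apply/colP => i; rewrite !mxE eqxx andbT.
  have [->|_] := eqVneq i k; last by rewrite subn0 addr0.
  by rewrite addrC; case: (x k 0) xk => // l _; rewrite subn1.
have AxE : A *m x = A *m x' + col k A by rewrite xE mulmxDr colE.
rewrite AxE in leAx *; apply: le_trans (mono _ _ leAx); apply: IH.
  rewrite -ltnS (leq_trans _ ltN) // ltnS (bigD1 k) //= [ltnRHS](bigD1 k) //=.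
  rewrite mxE eqxx subn1 -addSn prednK ?lt0n // leq_add2l leq_sum // => i _.
  by rewrite mxE leq_subr.
by move=> j; apply: leq_trans (leAx j); rewrite [leqRHS]mxE leq_addr.
Qed.

Theorem theorem11 (R : realType) (m n : nat) (beta b : 'cV[nat]_m)
    (A : 'M[nat]_(m, n))
    (hb : levec b beta) (hA : forall k : 'I_n, levec (col k A) beta) :
  let a_holds := exists x : 'cV[nat]_n, A *m x = b in
  let b_holds := exists2 xi : 'cV[R]_#|box beta|, cone A xi &
    (pxi xi).@[fun j => (b j 0)%:R] < 0 in
  (a_holds /\ ~ b_holds) \/ (~ a_holds /\ b_holds).
Proof.
move=> a_holds b_holds; have [aT|aF] := EM a_holds; [left|right]; split=> //.
  case: aT => x Ax [xi /(cone_box_eval _ hA) mono].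
  rewrite meval_pxi subr_lt0 -Ax ltNge => /negP; apply.
  by apply: le_of_nondecreasing_columns mono _; rewrite Ax.
pose f v : R := - (~~ `[< exists x : 'cV[nat]_n, A *m x = v >])%:R.
have [xi xiE] := box_eval_interpolation beta f.
have fT x : f (A *m x) = 0.
  by rewrite /f; case: asboolP => [_|[]]; [rewrite oppr0 | exists x].
exists xi.
  apply/(cone_box_eval _ hA) => k u leuA.
  have leu : levec u beta.
    by move=> j; apply: leq_trans (leuA j); rewrite [leqRHS]mxE leq_addr.
  (* If $u=Ax$, then $u+A_k=A(x+e_k)$ and both values are 0; otherwise $f(u)=-1$ is the least value
     of [f]. *)
  rewrite !xiE // {1}/f; case: asboolP => [[x <-]|_] /=.
    by rewrite oppr0 colE -mulmxDr fT.
  by rewrite lerN2; case: (~~ _).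
have f0 : f 0 = 0 by rewrite -(fT 0) mulmx0.
rewrite meval_pxi !xiE // ?f0 ?subr0 => [|j]; last by rewrite mxE.
by rewrite /f; case: asboolP => // _; rewrite oppr_lt0 ltr01.
Qed.
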